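(* Let $t\in\mathbb R$, $|t|<1$, and let $\mathcal P_n$ be the $n$-th Legendre polynomial. Then $$\frac1{2\pi}\int_{\mathbb T}\mathcal P_n\big(\sqrt{1-t^2}\cos\theta\big)\,d\theta=\delta_n\,\mathcal P_n(t),$$ where $$\delta_n=\begin{cases}(-1)^m\dfrac{(2m-1)!!}{(2m)!!}&\text{if } n=2m\text{ is even},\\[2mm] 0&\text{if } n\text{ is odd}.\end{cases}$$
   Context: $\mathbb T=\mathbb R/2\pi\mathbb Z$. The Legendre polynomials are defined by $(1-2\varepsilon t+\varepsilon^2)^{-1/2}=\sum_{n\ge0}\mathcal P_n(t)\varepsilon^n$. Conventions: $(-1)!!=0!!=1$. *)

(* Defs.v *)
From Stdlib Require Import Reals Lra Lia.
From Coquelicot Require Import Coquelicot.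
Open Scope R_scope.

(* For fixed t the generating function is analytic in eps near 0, on a
   neighbourhood that depends on t; the identity is required there.  By
   uniqueness of power series coefficients this determines P n t for all n
   and t, and [Legendre_exists] below shows that such a P exists. *)
Definition is_Legendre (P : nat -> R -> R) : Prop :=
  forall t : R, locally 0 (fun eps : R =>
    is_pseries (fun n : nat => P n t) eps
      (Rpower (1 - 2 * eps * t + eps ^ 2) (- (1 / 2)))).

Fixpoint dfact (n : nat) : nat :=
  match n with
  | S (S k as p) => S p * dfact k
  | _ => 1
  end%nat.

(* With m = 0, the truncated subtraction 2 * m - 1 is 0, and 0!! = 1 agrees
   with the convention (-1)!! = 1. *)
Definition delta (n : nat) : R :=
  if Nat.even n then
    let m := Nat.div2 n in
    (-1) ^ m * (INR (dfact (2 * m - 1)) / INR (dfact (2 * m)))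
  else 0.

Section Existence.

Fixpoint legendre_pair (t : R) (n : nat) : R * R :=
  match n with
  | O => (1, t)
  | S k => let (a, b) := legendre_pair t k in
      (b, ((2 * INR k + 3) * t * b - (INR k + 1) * a) / (INR k + 2))
  end.

Let legendre_rec (n : nat) (t : R) : R := fst (legendre_pair t n).

Let legendre_recE (t : R) (n : nat) :
  (INR n + 2) * legendre_rec (S (S n)) t =
  (2 * INR n + 3) * t * legendre_rec (S n) t - (INR n + 1) * legendre_rec n t.
Proof.
unfold legendre_rec; simpl.
destruct (legendre_pair t n) as [a b]; simpl.
assert (Hn := pos_INR n); field; lra.
Qed.

Let legendre_bound (t : R) (n : nat) :
  Rabs (legendre_rec n t) <= (2 * Rabs t + 1) ^ n /\
  Rabs (legendre_rec (S n) t) <= (2 * Rabs t + 1) ^ S n.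
Proof.
assert (Ht := Rabs_pos t).
set (K := 2 * Rabs t + 1).
induction n as [|n [IH0 IH1]].
- unfold legendre_rec; simpl; rewrite Rabs_R1; unfold K; lra.
- split; [exact IH1|].
  assert (Hn := pos_INR n).
  assert (E : legendre_rec (S (S n)) t =
    (2 * INR n + 3) / (INR n + 2) * (t * legendre_rec (S n) t)
    - (INR n + 1) / (INR n + 2) * legendre_rec n t).
  { apply Rmult_eq_reg_l with (INR n + 2); [|lra].
    rewrite legendre_recE; field; lra. }
  rewrite E.
  eapply Rle_trans; [apply Rabs_triang|].
  rewrite Rabs_Ropp, !Rabs_mult.
  assert (H1 : 0 <= (2 * INR n + 3) / (INR n + 2) <= 2).
  { split; [apply Rdiv_le_0_compat; lra|].
    apply Rmult_le_reg_r with (INR n + 2); [lra|].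
    unfold Rdiv; rewrite Rmult_assoc, Rinv_l; lra. }
  assert (H2 : 0 <= (INR n + 1) / (INR n + 2) <= 1).
  { split; [apply Rdiv_le_0_compat; lra|].
    apply Rmult_le_reg_r with (INR n + 2); [lra|].
    unfold Rdiv; rewrite Rmult_assoc, Rinv_l; lra. }
  rewrite (Rabs_pos_eq ((2 * INR n + 3) / _)) by lra.
  rewrite (Rabs_pos_eq ((INR n + 1) / _)) by lra.
  assert (HKn : 0 <= K ^ n) by (apply pow_le; unfold K; lra).
  assert (HK1 : K ^ n <= K ^ S n) by (simpl; unfold K in *; nra).
  apply Rle_trans with (2 * (Rabs t * K ^ S n) + 1 * K ^ S n).
  + apply Rplus_le_compat; apply Rmult_le_compat; try lra;
      try apply Rabs_pos.
    * apply Rmult_le_pos; apply Rabs_pos.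
    * apply Rmult_le_compat_l; [exact Ht | exact IH1].
  + right; unfold K; simpl; ring.
Qed.

Let legendre_CV (t x : R) : Rabs x < / (2 * Rabs t + 1) ->
  Rbar_lt (Rabs x) (CV_radius (fun n => legendre_rec n t)).
Proof.
intros Hx.
assert (Ht := Rabs_pos t).
assert (HK : 0 < / (2 * Rabs t + 1)) by (apply Rinv_0_lt_compat; lra).
apply Rbar_lt_le_trans with (Finite (/ (2 * Rabs t + 1))); [exact Hx|].
apply (proj1 (CV_radius_bounded _)).
exists 1; intros n.
rewrite Rabs_mult, <- RPow_abs, (Rabs_pos_eq (/ _)) by lra.
replace 1 with ((2 * Rabs t + 1) ^ n * (/ (2 * Rabs t + 1)) ^ n) at 2.
- apply Rmult_le_compat_r; [apply pow_le; lra|].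
  apply legendre_bound.
- rewrite <- Rpow_mult_distr, Rinv_r by lra; apply pow1.
Qed.

Let legendre_ode (t x : R) : Rabs x < / (2 * Rabs t + 1) ->
  let a := fun n => legendre_rec n t in
  (1 - 2 * x * t + x ^ 2) * PSeries (PS_derive a) x = (t - x) * PSeries a x.
Proof.
intros Hx a.
assert (Ha : ex_pseries a x) by (apply CV_radius_inside, legendre_CV, Hx).
assert (Hd : ex_pseries (PS_derive a) x).
{ apply CV_radius_inside; rewrite CV_radius_derive; apply legendre_CV, Hx. }
assert (C : forall c : R, mult x c = mult c x)
  by (intros c; apply Rmult_comm).
set (d := PS_derive a).
assert (E : PSeries (PS_plus d (PS_plus (PS_incr_1 (PS_incr_1 d))
                                        (PS_incr_1 a))) x =
  PSeries (PS_plus (PS_scal t a) (PS_scal (2 * t) (PS_incr_1 d))) x).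
{ apply PSeries_ext; intros [|[|n]];
    unfold d, PS_plus, PS_scal, PS_incr_1, PS_derive, a;
    rewrite ?S_INR; simpl (INR 0);
    unfold plus, scal, zero; simpl; unfold mult; simpl.
  - unfold legendre_rec; simpl; ring.
  - assert (H := legendre_recE t 0); simpl (INR 0) in H.
    unfold legendre_rec in *; simpl in *; lra.
  - assert (H := legendre_recE t (S n)); rewrite S_INR in H.
    rewrite ?S_INR in *.
    fold (INR (S n)); rewrite ?S_INR; lra. }
rewrite !PSeries_plus in E;
  auto 6 using ex_pseries_plus, ex_pseries_incr_1, ex_pseries_scal.
rewrite !PSeries_scal, !PSeries_incr_1 in E.
fold d; lra.
Qed.

Lemma Legendre_exists : exists P : nat -> R -> R, is_Legendre P.
Proof.
exists legendre_rec; intros t.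
assert (Ht := Rabs_pos t).
assert (HK : 0 < / (2 * Rabs t + 1)) by (apply Rinv_0_lt_compat; lra).
exists (mkposreal _ HK); intros x Hx.
assert (Hx' : Rabs x < / (2 * Rabs t + 1)).
{ replace x with (x - 0) by ring; exact Hx. }
clear Hx.
set (a := fun n => legendre_rec n t).
set (q := fun y => 1 - 2 * y * t + y ^ 2).
assert (Hq : forall y, Rabs y <= Rabs x -> 0 < q y).
{ intros y Hy; unfold q.
  assert (H1 : Rabs y * (2 * Rabs t + 1) < 1).
  { apply Rmult_lt_reg_r with (/ (2 * Rabs t + 1)); [exact HK|].
    rewrite Rmult_assoc, Rinv_r; lra. }
  assert (H2 : y * t <= Rabs y * Rabs t)
    by (rewrite <- Rabs_mult; apply Rle_abs).
  assert (H3 := Rabs_pos y).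
  assert (H4 := pow2_ge_0 y).
  nra. }
assert (Hh : forall y, Rabs y <= Rabs x ->
  is_derive (fun y => PSeries a y * sqrt (q y)) y 0).
{ intros y Hy.
  assert (Hy' : Rabs y < / (2 * Rabs t + 1)) by lra.
  assert (D1 := is_derive_PSeries a y (legendre_CV t y Hy')).
  assert (Q := Hq y Hy).
  assert (S0 := sqrt_lt_R0 _ Q).
  assert (SS := sqrt_sqrt (q y) (Rlt_le _ _ Q)).
  assert (D2 : is_derive (fun y => sqrt (q y)) y ((y - t) / sqrt (q y))).
  { unfold q in *; auto_derive; [lra|].
    replace (1 + - (2 * y * t) + y * (y * 1)) with (1 - 2 * y * t + y ^ 2)
      by ring.
    field; lra. }
  assert (O := legendre_ode t y Hy'); simpl in O; fold a in O.
  evar_last; [apply (is_derive_mult _ _ _ _ _ D1 D2), Rmult_comm|].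
  unfold plus, mult; simpl.
  apply Rmult_eq_reg_r with (sqrt (q y)); [|lra].
  replace (y * 1) with y in O by ring.
  replace ((PSeries (PS_derive a) y * sqrt (q y)
    + PSeries a y * ((y - t) / sqrt (q y))) * sqrt (q y))
    with (PSeries (PS_derive a) y * (sqrt (q y) * sqrt (q y))
      + PSeries a y * (y - t)) by (field; lra).
  rewrite SS; unfold q; simpl; lra. }
assert (H0 : PSeries a 0 * sqrt (q 0) = 1).
{ rewrite PSeries_0; unfold q.
  replace (1 - 2 * 0 * t + 0 ^ 2) with 1 by ring.
  rewrite sqrt_1; unfold a, legendre_rec; simpl; ring. }
assert (Hc : PSeries a x * sqrt (q x) = 1).
{ rewrite <- H0.
  destruct (Rtotal_order x 0) as [Hn|[->|Hp]]; [|reflexivity|].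
  - apply (eq_is_derive (fun y => PSeries a y * sqrt (q y))); [|exact Hn].
    intros y Hy; apply Hh; rewrite !Rabs_left1; lra.
  - symmetry.
    apply (eq_is_derive (fun y => PSeries a y * sqrt (q y))); [|exact Hp].
    intros y Hy; apply Hh; rewrite !Rabs_pos_eq; lra. }
fold a; fold (q x).
assert (Q := Hq x (Rle_refl _)).
assert (S0 := sqrt_lt_R0 _ Q).
replace (Rpower (q x) (- (1 / 2))) with (PSeries a x).
- apply PSeries_correct, CV_radius_inside, legendre_CV, Hx'.
- rewrite Rpower_Ropp.
  replace (1 / 2) with (/ 2) by lra.
  rewrite Rpower_sqrt by exact Q.
  apply Rmult_eq_reg_r with (sqrt (q x)); [|lra].
  rewrite Hc, Rinv_l; lra.
Qed.

End Existence.

(* Main.v *)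
Require Import Defs.
From Stdlib Require Import Reals Lra Lia Factorial.
From Coquelicot Require Import Coquelicot.
Open Scope R_scope.

(** Write F(a, b; c; z) for the Gauss hypergeometric series and [u = 1 - t ^ 2].
    An even Legendre polynomial has two expansions, at the centre 0 and at the
    endpoint 1 of its interval (lemmas [Legendre_expansion_at_0] and
    [Legendre_expansion_at_1]):

      P_2m(x) = delta_2m F(-m, m + 1/2; 1/2; x^2),
      P_2m(t) = F(-m, m + 1/2; 1; 1 - t^2).

    They differ only in the parameter c, in the argument and in the factor
    delta_2m = P_2m(0).  The coefficient of z^j has (c)_j in its denominator,
    and the mean of cos^(2j) over the circle is (1/2)_j / j!
    = (1/2)_j / (1)_j.  So averaging the first expansion at
    [x = sqrt u * cos theta] replaces c = 1/2 by c = 1 and x^2 by u, which gives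
    delta_2m times the second expansion ([is_RInt_hyp_cos2]).  For odd n the
    polynomial P_n is odd, and odd powers of cosine have mean zero.

    Both expansions, together with their analogues for odd degree, follow by
    induction on m from Bonnet's recurrence (n + 2) P_(n+2) =
    (2n + 3) x P_(n+1) - (n + 1) P_n.  Each half of the induction step, to an
    even and to an odd degree, is one contiguous relation of Gauss between
    hypergeometric series.  Bonnet's recurrence itself is the differential
    equation of the generating function read off on coefficients. *)

(** * Bonnet's recurrence *)

(** Convergence at a point bounds the radius from below only weakly; the strict
    inequality comes from convergence at a point a little further out. *)
Lemma locally_lt_CV_radius (a : nat -> R) :
  locally 0 (ex_pseries a) ->
  locally 0 (fun x : R => Rbar_lt (Rabs x) (CV_radius a)).
Proof.
intros [e He]; exists e; intros x Hx.
change (Rabs (x - 0) < e) in Hx; rewrite Rminus_0_r in Hx.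
assert (H0 := Rabs_pos x).
apply Rbar_lt_le_trans with (Finite ((Rabs x + e) / 2)); [simpl; lra|].
replace ((Rabs x + e) / 2) with (Rabs ((Rabs x + e) / 2))
  by (apply Rabs_pos_eq; lra).
apply Rbar_not_lt_le; intros H.
apply (CV_disk_outside _ _ H).
apply (ex_series_lim_0 (fun n => a n * ((Rabs x + e) / 2) ^ n)).
apply ex_pseries_R, He.
change (Rabs ((Rabs x + e) / 2 - 0) < e).
rewrite Rminus_0_r, Rabs_pos_eq; lra.
Qed.

Lemma is_derive_Legendre_generating (t x : R) :
  0 < 1 - 2 * x * t + x ^ 2 ->
  is_derive (fun y => Rpower (1 - 2 * y * t + y ^ 2) (- (1 / 2))) x
    ((t - x) / (1 - 2 * x * t + x ^ 2)
     * Rpower (1 - 2 * x * t + x ^ 2) (- (1 / 2))).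
Proof.
intros Hq; unfold Rpower.
auto_derive.
- simpl in Hq; lra.
- replace (1 + - (2 * x * t) + x * (x * 1)) with (1 - 2 * x * t + x ^ 2)
    by ring.
  field; lra.
Qed.

Lemma locally_generating_base_pos (t : R) :
  locally 0 (fun x : R => 0 < 1 - 2 * x * t + x ^ 2).
Proof.
assert (C : continuous (fun x : R => 1 - 2 * x * t + x ^ 2) 0)
  by (apply (ex_derive_continuous (V := R_NormedModule)); auto_derive; auto).
apply (C (fun y => 0 < y)), open_gt; simpl; lra.
Qed.

(** Differentiating the generating function [f] gives
    [(1 - 2 * x * t + x ^ 2) * f' = (t - x) * f]; both sides are power series
    in [x] near 0. *)
Lemma Legendre_generating_ode (a : nat -> R) (t : R) :
  locally 0 (fun x : R =>
    is_pseries a x (Rpower (1 - 2 * x * t + x ^ 2) (- (1 / 2)))) ->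
  locally 0 (fun x : R =>
    (1 - 2 * x * t + x ^ 2) * PSeries (PS_derive a) x
    = (t - x) * PSeries a x).
Proof.
intros Ha.
assert (Hex : locally 0 (ex_pseries a))
  by (revert Ha; apply filter_imp; intros x Hx; eexists; exact Hx).
assert (Hr := locally_lt_CV_radius a Hex).
assert (Hq := locally_generating_base_pos t).
generalize (filter_and _ _ (locally_locally _ _ Ha) (filter_and _ _ Hr Hq)).
apply filter_imp; intros x [Hx [Hxr Hxq]].
assert (E := is_pseries_unique _ _ _ (locally_singleton _ _ Hx)).
assert (D : is_derive (PSeries a) x
  ((t - x) / (1 - 2 * x * t + x ^ 2) * PSeries a x)).
{ rewrite E.
  eapply is_derive_ext_loc; [|apply is_derive_Legendre_generating, Hxq].
  revert Hx; apply filter_imp; intros y Hy; symmetry.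
  apply is_pseries_unique, Hy. }
apply is_derive_unique in D.
rewrite Derive_PSeries in D by exact Hxr.
rewrite D; field; lra.
Qed.

(** The differential equation of the generating function, compared coefficient
    by coefficient; [l] and [r] below collect the terms so that neither side
    contains a subtraction. *)
Lemma Legendre_coeff_rec (P : nat -> R -> R) (t : R) : is_Legendre P ->
  P 0%nat t = 1 /\ P 1%nat t = t /\
  forall n, (INR n + 2) * P (S (S n)) t
    = (2 * INR n + 3) * t * P (S n) t - (INR n + 1) * P n t.
Proof.
intros hP; specialize (hP t).
set (a := fun n => P n t) in hP.
assert (Hex : locally 0 (ex_pseries a))
  by (revert hP; apply filter_imp; intros x Hx; eexists; exact Hx).
assert (Hl := locally_lt_CV_radius a Hex).
assert (H0 : P 0%nat t = 1).
{ apply locally_singleton, is_pseries_unique in hP.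
  rewrite PSeries_0 in hP; change (P 0%nat t) with (a 0%nat); rewrite hP.
  replace (1 - 2 * 0 * t + 0 ^ 2) with 1 by ring.
  unfold Rpower; rewrite ln_1, Rmult_0_r; apply exp_0. }
set (d := PS_derive a).
set (l := PS_plus d (PS_plus (PS_incr_1 (PS_incr_1 d)) (PS_incr_1 a))).
set (r := PS_plus (PS_scal t a) (PS_scal (2 * t) (PS_incr_1 d))).
assert (C : forall c x : R, mult x c = mult c x)
  by (intros c x; apply Rmult_comm).
assert (Hlr : forall n, l n = r n).
{ assert (Hd : forall x : R, Rbar_lt (Rabs x) (CV_radius a) ->
    ex_pseries a x /\ ex_pseries d x).
  { intros x Hx; split; apply CV_radius_inside; [exact Hx|].
    unfold d; rewrite CV_radius_derive; exact Hx. }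
  assert (L : forall b, (forall x : R, Rbar_lt (Rabs x) (CV_radius a) ->
    ex_pseries b x) -> Rbar_lt 0 (CV_radius b)).
  { intros b Hb; rewrite <- Rabs_R0.
    apply (locally_singleton _ (fun x : R => Rbar_lt (Rabs x) (CV_radius b))).
    apply locally_lt_CV_radius; revert Hl; apply filter_imp, Hb. }
  intros n; apply PSeries_ext_recip;
    [apply L; intros x Hx; destruct (Hd x Hx); unfold l, r;
     auto 6 using ex_pseries_plus, ex_pseries_incr_1, ex_pseries_scal ..|].
  generalize (filter_and _ _ Hl (Legendre_generating_ode _ _ hP)).
  apply filter_imp; intros x [Hx O]; fold d in O.
  destruct (Hd x Hx); unfold l, r.
  rewrite !PSeries_plus;
    auto 6 using ex_pseries_plus, ex_pseries_incr_1, ex_pseries_scal.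
  rewrite !PSeries_scal, !PSeries_incr_1; lra. }
assert (E0 := Hlr 0%nat).
unfold l, r, d, PS_plus, PS_scal, PS_incr_1, PS_derive, plus, scal, zero, a
  in E0; simpl in E0; unfold mult in E0; simpl in E0.
assert (H1 : P 1%nat t = t) by (rewrite H0 in E0; lra).
split; [exact H0|split; [exact H1|]].
intros n; assert (E := Hlr (S n)).
unfold l, r, d, PS_plus, PS_scal, PS_incr_1, PS_derive, plus, scal, zero, a
  in E.
destruct n as [|n]; rewrite !S_INR in E; simpl in E; unfold mult in E;
  simpl in E; [simpl; lra|].
rewrite S_INR in *; lra.
Qed.

(** * Gauss hypergeometric polynomials *)

(** The rising factorial (a)_j. *)
Fixpoint poch (a : R) (j : nat) : R :=
  match j with
  | O => 1
  | S k => poch a k * (a + INR k)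
  end.

Lemma poch_S_l (a : R) (j : nat) : poch a (S j) = a * poch (a + 1) j.
Proof.
induction j as [|j IH]; [simpl; ring|].
change (poch a (S (S j))) with (poch a (S j) * (a + INR (S j))).
rewrite IH, S_INR; simpl; ring.
Qed.

Lemma poch_shift (a : R) (j : nat) :
  a * poch (a + 1) j = poch a j * (a + INR j).
Proof. rewrite <- poch_S_l; reflexivity. Qed.

Lemma poch_pos (a : R) (j : nat) : 0 < a -> 0 < poch a j.
Proof.
intros Ha; induction j as [|j IH]; simpl; [lra|].
assert (H := pos_INR j); apply Rmult_lt_0_compat; lra.
Qed.

Lemma poch_opp_INR (m : nat) : poch (- INR m) (S m) = 0.
Proof. simpl; ring. Qed.

Definition hyp_coef (a b c : R) (j : nat) : R :=
  poch a j * poch b j / (poch c j * INR (fact j)).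

(** The series 2F1(a, b; c; z) cut after the term of degree [N]; it is the
    whole series when [a = - INR N]. *)
Definition hyp (N : nat) (a b c z : R) : R :=
  sum_f_R0 (fun j => hyp_coef a b c j * z ^ j) N.

(** Splitting off the constant term exposes a factor [z], which lets series with
    a factor [z] and cut one degree earlier be compared termwise. *)
Lemma hyp_S_l (N : nat) (a b c z : R) :
  hyp (S N) a b c z
  = 1 + z * sum_f_R0 (fun j => hyp_coef a b c (S j) * z ^ j) N.
Proof.
unfold hyp; rewrite decomp_sum by lia; simpl Init.Nat.pred.
rewrite scal_sum; f_equal.
- unfold hyp_coef; simpl; field.
- apply sum_eq; intros j _; simpl; ring.
Qed.

Lemma hyp_terminates (m : nat) (b c z : R) :
  hyp (S m) (- INR m) b c z = hyp m (- INR m) b c z.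
Proof.
unfold hyp; rewrite tech5; unfold hyp_coef at 2.
rewrite poch_opp_INR; unfold Rdiv; ring.
Qed.

(** The four relations below are the relations of Gauss between contiguous
    series.  They hold coefficient by coefficient, so they hold for truncated
    series whether or not the series terminates; a factor [z] only shifts the
    degree of truncation by one. *)

(** This one and [hyp_contiguous_one_sub] carry the induction at 1. *)
Lemma hyp_contiguous_ab (N : nat) (a b c z : R) : 0 < c ->
  (b - a) * hyp N a b c z
  = b * hyp N a (b + 1) c z - a * hyp N (a + 1) b c z.
Proof.
intros Hc; unfold hyp; rewrite !scal_sum, <- minus_sum.
apply sum_eq; intros j _; unfold hyp_coef.
assert (Hj := poch_pos c j Hc); assert (Hf := INR_fact_neq_0 j).
assert (Ea := poch_shift a j); assert (Eb := poch_shift b j).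
transitivity (z ^ j * (poch a j * (b * poch (b + 1) j)
  - a * poch (a + 1) j * poch b j) / (poch c j * INR (fact j))).
- rewrite Ea, Eb; field; lra.
- field; lra.
Qed.

(** This one and [hyp_contiguous_shift] carry the induction at 0. *)
Lemma hyp_contiguous_abc (N : nat) (a b c z : R) : 0 < c ->
  (b - a) * c * hyp N a b c z
  = b * (c - a) * hyp N a (b + 1) (c + 1) z
    - a * (c - b) * hyp N (a + 1) b (c + 1) z.
Proof.
intros Hc; unfold hyp; rewrite !scal_sum, <- minus_sum.
apply sum_eq; intros j _; unfold hyp_coef.
assert (Hj := poch_pos c j Hc); assert (Hf := INR_fact_neq_0 j).
assert (Hi := pos_INR j).
assert (Ea := poch_shift a j); assert (Eb := poch_shift b j).
replace (poch (c + 1) j) with (poch c j * (c + INR j) / c)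
  by (rewrite <- poch_shift; field; lra).
transitivity (z ^ j * c * (poch a j * (b * poch (b + 1) j) * (c - a)
  - a * poch (a + 1) j * poch b j * (c - b))
  / (poch c j * (c + INR j) * INR (fact j))).
- rewrite Ea, Eb; field; repeat split; lra.
- field; repeat split; lra.
Qed.

Lemma hyp_contiguous_one_sub (N : nat) (a b c z : R) : 0 < c ->
  (b - a) * (hyp (S N) (a + 1) (b + 1) c z - z * hyp N (a + 1) (b + 1) c z)
  = (c - a - 1) * hyp (S N) a (b + 1) c z
    - (c - b - 1) * hyp (S N) (a + 1) b c z.
Proof.
intros Hc; rewrite !hyp_S_l.
set (A := sum_f_R0 _ N); set (B := sum_f_R0 _ N); set (C := sum_f_R0 _ N).
enough (E : (b - a) * (A - hyp N (a + 1) (b + 1) c z)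
  = (c - a - 1) * B - (c - b - 1) * C)
  by (apply (f_equal (Rmult z)) in E; lra).
unfold A, B, C, hyp.
rewrite <- minus_sum, !scal_sum, <- minus_sum.
apply sum_eq; intros j _; unfold hyp_coef.
rewrite (poch_S_l a), (poch_S_l b), fact_simpl, mult_INR, S_INR; simpl poch.
assert (Hj := poch_pos c j Hc); assert (Hf := INR_fact_neq_0 j).
assert (Hi := pos_INR j).
field; repeat split; lra.
Qed.

Lemma hyp_contiguous_shift (N : nat) (a b c z : R) : 0 < c ->
  c * (hyp (S N) a (b + 1) c z - hyp (S N) (a + 1) b c z)
  = (a - b) * (z * hyp N (a + 1) (b + 1) (c + 1) z).
Proof.
intros Hc; rewrite !hyp_S_l.
set (A := sum_f_R0 _ N); set (B := sum_f_R0 _ N).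
enough (E : c * (A - B) = (a - b) * hyp N (a + 1) (b + 1) (c + 1) z)
  by (apply (f_equal (Rmult z)) in E; lra).
unfold A, B, hyp.
rewrite <- minus_sum, !scal_sum.
apply sum_eq; intros j _; unfold hyp_coef.
rewrite (poch_S_l a), (poch_S_l b), (poch_S_l c), fact_simpl, mult_INR, S_INR.
simpl poch.
assert (Hc' : 0 < c + 1) by lra.
assert (Hj := poch_pos (c + 1) j Hc'); assert (Hf := INR_fact_neq_0 j).
assert (Hi := pos_INR j).
field; repeat split; lra.
Qed.

(** * Two expansions of the Legendre polynomials *)

Lemma delta_0 : delta 0 = 1.
Proof. unfold delta; simpl; field. Qed.

Lemma delta_odd (m : nat) : delta (2 * m + 1) = 0.
Proof.
unfold delta; rewrite Nat.even_odd; reflexivity.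
Qed.

Lemma dfact_pos (n : nat) : (0 < dfact n /\ 0 < dfact (S n))%nat.
Proof. induction n as [|n [H1 H2]]; simpl in *; lia. Qed.

Lemma delta_even (m : nat) :
  delta (2 * m)
  = (-1) ^ m * (INR (dfact (2 * m - 1)) / INR (dfact (2 * m))).
Proof.
unfold delta; rewrite Nat.even_even, Nat.div2_double; reflexivity.
Qed.

Lemma delta_even_S (m : nat) :
  (2 * INR m + 2) * delta (2 * S m) = - (2 * INR m + 1) * delta (2 * m).
Proof.
rewrite !delta_even.
assert (E1 : dfact (2 * S m) = (2 * S m * dfact (2 * m))%nat)
  by (replace (2 * S m)%nat with (S (S (2 * m))) by lia; reflexivity).
assert (E2 : dfact (2 * S m - 1) = ((2 * m + 1) * dfact (2 * m - 1))%nat).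
{ destruct m as [|m]; [reflexivity|].
  replace (2 * S (S m) - 1)%nat with (S (S (2 * S m - 1))) by lia.
  replace (2 * S m + 1)%nat with (S (S (2 * S m - 1))) by lia; reflexivity. }
assert (H := lt_0_INR _ (proj1 (dfact_pos (2 * m)))).
assert (Hm := pos_INR m).
rewrite E1, E2, !mult_INR, plus_INR, mult_INR, (S_INR m), <- tech_pow_Rmult.
change (INR 2) with 2; change (INR 1) with 1.
field; split; lra.
Qed.

Lemma Legendre_rec_by_parity (P : nat -> R -> R) (m : nat) (x : R) :
  is_Legendre P ->
  (2 * INR m + 2) * P (2 * S m)%nat x
    = (4 * INR m + 3) * (x * P (2 * m + 1)%nat x)
      - (2 * INR m + 1) * P (2 * m)%nat x
  /\
  (2 * INR m + 3) * P (2 * S m + 1)%nat x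
    = (4 * INR m + 5) * (x * P (2 * S m)%nat x)
      - (2 * INR m + 2) * P (2 * m + 1)%nat x.
Proof.
intros hP; destruct (Legendre_coeff_rec P x hP) as [_ [_ Hrec]].
assert (Re := Hrec (2 * m)%nat); assert (Ro := Hrec (2 * m + 1)%nat).
replace (S (S (2 * m))) with (2 * S m)%nat in Re by lia.
replace (S (2 * m)) with (2 * m + 1)%nat in Re by lia.
replace (S (S (2 * m + 1))) with (2 * S m + 1)%nat in Ro by lia.
replace (S (2 * m + 1)) with (2 * S m)%nat in Ro by lia.
rewrite mult_INR in Re; rewrite plus_INR, mult_INR in Ro.
change (INR 2) with 2 in Re, Ro; change (INR 1) with 1 in Ro.
split; lra.
Qed.

(** The factor [2 * INR m + 1] makes the leading factor for odd degree the
    derivative of the polynomial at 0. *)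
Lemma Legendre_expansion_at_0 (P : nat -> R -> R) (m : nat) (x : R) :
  is_Legendre P ->
  P (2 * m)%nat x
    = delta (2 * m) * hyp m (- INR m) (INR m + 1 / 2) (1 / 2) (x ^ 2)
  /\
  P (2 * m + 1)%nat x
    = (2 * INR m + 1) * delta (2 * m)
      * (x * hyp m (- INR m) (INR m + 3 / 2) (3 / 2) (x ^ 2)).
Proof.
intros hP; induction m as [|m [IHe IHo]].
{ destruct (Legendre_coeff_rec P x hP) as [H0 [H1 _]].
  simpl (2 * 0)%nat; simpl Nat.add; rewrite H0, H1, delta_0.
  unfold hyp, hyp_coef; simpl; split; field. }
assert (Hm := pos_INR m).
assert (D := delta_even_S m).
destruct (Legendre_rec_by_parity P m x hP) as [Re Ro].
(* [Ge] gives the step to degree [2 * S m], [Go] the step to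
   [2 * S m + 1]. *)
assert (Ge := hyp_contiguous_shift m (- INR (S m)) (INR m + 1 / 2) (1 / 2)
  (x ^ 2) ltac:(lra)).
assert (Go := hyp_contiguous_abc (S m) (- INR (S m)) (INR m + 3 / 2) (1 / 2)
  (x ^ 2) ltac:(lra)).
rewrite IHo, IHe, <- (hyp_terminates m (INR m + 1 / 2)) in Re.
rewrite IHo, <- (hyp_terminates m (INR m + 3 / 2)) in Ro.
clear IHe IHo.
rewrite S_INR in *.
replace (- (INR m + 1) + 1) with (- INR m) in Ge, Go by ring.
replace (INR m + 1 / 2 + 1) with (INR m + 3 / 2) in Ge by field.
replace (INR m + 3 / 2 + 1) with (INR m + 1 + 3 / 2) in Go by field.
replace (1 / 2 + 1) with (3 / 2) in Ge, Go by field.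
replace (INR m + 1 + 1 / 2) with (INR m + 3 / 2) by field.
set (d := delta (2 * m)) in *; set (d' := delta (2 * S m)) in *.
assert (Pe : P (2 * S m)%nat x
  = d' * hyp (S m) (- (INR m + 1)) (INR m + 3 / 2) (1 / 2) (x ^ 2)).
{ apply Rmult_eq_reg_l with (2 * INR m + 2); [|lra].
  rewrite Re, <- (Rmult_assoc _ d'), D.
  apply (f_equal (Rmult ((2 * INR m + 1) * d))) in Ge; lra. }
split; [exact Pe|].
apply Rmult_eq_reg_l with (2 * INR m + 3); [|lra].
rewrite Ro, Pe.
replace ((2 * INR m + 1) * d) with (- ((2 * INR m + 2) * d'))
  by (rewrite D; ring).
apply (f_equal (Rmult (d' * x))) in Go; lra.
Qed.

(** No factor appears in front of the series, because all Legendre polynomials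
    take the value 1 at 1. *)
Lemma Legendre_expansion_at_1 (P : nat -> R -> R) (m : nat) (x : R) :
  is_Legendre P ->
  P (2 * m)%nat x = hyp m (- INR m) (INR m + 1 / 2) 1 (1 - x ^ 2)
  /\
  P (2 * m + 1)%nat x = x * hyp m (- INR m) (INR m + 3 / 2) 1 (1 - x ^ 2).
Proof.
intros hP; induction m as [|m [IHe IHo]].
{ destruct (Legendre_coeff_rec P x hP) as [H0 [H1 _]].
  simpl (2 * 0)%nat; simpl Nat.add; rewrite H0, H1.
  unfold hyp, hyp_coef; simpl; split; field. }
assert (Hm := pos_INR m).
destruct (Legendre_rec_by_parity P m x hP) as [Re Ro].
assert (Ge := hyp_contiguous_one_sub m (- INR (S m)) (INR m + 1 / 2) 1
  (1 - x ^ 2) ltac:(lra)).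
assert (Go := hyp_contiguous_ab (S m) (- INR (S m)) (INR m + 3 / 2) 1
  (1 - x ^ 2) ltac:(lra)).
rewrite S_INR in *.
replace (- (INR m + 1) + 1) with (- INR m) in Ge, Go by ring.
replace (INR m + 1 / 2 + 1) with (INR m + 3 / 2) in Ge by field.
replace (INR m + 3 / 2 + 1) with (INR m + 1 + 3 / 2) in Go by field.
replace (INR m + 1 + 1 / 2) with (INR m + 3 / 2) by field.
rewrite !hyp_terminates in Ge; rewrite hyp_terminates in Go.
rewrite IHo, IHe in Re; rewrite IHo in Ro.
assert (Pe : P (2 * S m)%nat x
  = hyp (S m) (- (INR m + 1)) (INR m + 3 / 2) 1 (1 - x ^ 2)).
{ apply Rmult_eq_reg_l with (2 * INR m + 2); [|lra].
  rewrite Re; lra. }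
split; [exact Pe|].
apply Rmult_eq_reg_l with (2 * INR m + 3); [|lra].
rewrite Ro, Pe.
apply (f_equal (Rmult x)) in Go; lra.
Qed.

(** * Averaging over the circle *)

Lemma is_RInt_Rmult_l (f : R -> R) (k a b l : R) :
  is_RInt f a b l -> is_RInt (fun x => k * f x) a b (k * l).
Proof. apply (is_RInt_scal (V := R_NormedModule)). Qed.

(** Integrate the derivative of [sin x * cos x ^ (k + 1)], which is
    [(k + 2) * cos x ^ (k + 2) - (k + 1) * cos x ^ k]. *)
Lemma is_RInt_cos_pow_SS (k : nat) (l : R) :
  is_RInt (fun x => cos x ^ k) 0 (2 * PI) l ->
  is_RInt (fun x => cos x ^ S (S k)) 0 (2 * PI)
    ((INR k + 1) / (INR k + 2) * l).
Proof.
intros Hk.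
assert (Hi := pos_INR k).
set (g := fun x => sin x * cos x ^ S k).
assert (Hg : is_RInt (fun x => (INR k + 2) * cos x ^ S (S k)
  - (INR k + 1) * cos x ^ k) 0 (2 * PI) (minus (g (2 * PI)) (g 0))).
{ apply (is_RInt_derive (V := R_CompleteNormedModule)).
  - intros x _; unfold g; auto_derive; [exact I|].
    change (match k with 0%nat => 1 | S _ => INR k + 1 end) with (INR (S k)).
    rewrite S_INR; simpl pow.
    assert (E := sin2_cos2 x); unfold Rsqr in E.
    apply (f_equal (Rmult ((INR k + 1) * cos x ^ k))) in E; lra.
  - intros x _; apply (ex_derive_continuous (V := R_NormedModule)).
    auto_derive; auto. }
apply (is_RInt_Rmult_l _ (INR k + 1)) in Hk.
assert (H := is_RInt_Rmult_l _ (/ (INR k + 2)) _ _ _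
  (is_RInt_plus _ _ _ _ _ _ Hg Hk)).
evar_last; [eapply is_RInt_ext; [|exact H]|].
- intros x _; unfold plus, scal; simpl; unfold mult; simpl; field; lra.
- unfold g, minus, plus, opp, scal; simpl; unfold mult; simpl.
  rewrite sin_2PI, sin_0; field; lra.
Qed.

Lemma is_RInt_cos_pow_even (j : nat) :
  is_RInt (fun x => cos x ^ (2 * j)) 0 (2 * PI)
    (2 * PI * (poch (1 / 2) j / INR (fact j))).
Proof.
induction j as [|j IH].
- evar_last; [apply (is_RInt_const (V := R_NormedModule) 0 (2 * PI) 1)|].
  unfold scal; simpl; unfold mult; simpl; field.
- replace (2 * S j)%nat with (S (S (2 * j))) by lia.
  evar_last; [apply is_RInt_cos_pow_SS, IH|].
  rewrite fact_simpl, !mult_INR, (S_INR j); simpl poch.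
  change (INR 2) with 2.
  assert (Hj := pos_INR j); assert (Hf := INR_fact_neq_0 j).
  field; repeat split; lra.
Qed.

Lemma is_RInt_cos_pow_odd (j : nat) :
  is_RInt (fun x => cos x ^ (2 * j + 1)) 0 (2 * PI) 0.
Proof.
induction j as [|j IH].
- evar_last; [apply (is_RInt_derive (V := R_CompleteNormedModule) sin)|].
  + intros x _; simpl; auto_derive; [exact I | ring].
  + intros x _; apply (ex_derive_continuous (V := R_NormedModule)).
    auto_derive; auto.
  + unfold minus, plus, opp; simpl; rewrite sin_2PI, sin_0; ring.
- replace (2 * S j + 1)%nat with (S (S (2 * j + 1))) by lia.
  evar_last; [apply is_RInt_cos_pow_SS, IH | apply Rmult_0_r].
Qed.

Lemma is_RInt_sum_f_R0 (f : nat -> R -> R) (l : nat -> R) (a b : R) (N : nat) :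
  (forall j, is_RInt (f j) a b (l j)) ->
  is_RInt (fun x => sum_f_R0 (fun j => f j x) N) a b (sum_f_R0 l N).
Proof.
intros H; induction N as [|N IH]; [apply H|].
apply (is_RInt_plus (V := R_NormedModule)); [exact IH | apply H].
Qed.

(** The factor [(1/2)_j] of the mean of [cos ^ (2 * j)] cancels the one in the
    denominator of the coefficient, and [j!], which is [(1)_j], takes its
    place. *)
Lemma is_RInt_hyp_cos2 (N : nat) (a b s : R) :
  is_RInt (fun x => hyp N a b (1 / 2) ((s * cos x) ^ 2)) 0 (2 * PI)
    (2 * PI * hyp N a b 1 (s ^ 2)).
Proof.
unfold hyp; rewrite scal_sum.
apply is_RInt_sum_f_R0; intros j.
assert (H := is_RInt_Rmult_l _ (hyp_coef a b (1 / 2) j * s ^ (2 * j)) _ _ _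
  (is_RInt_cos_pow_even j)).
evar_last; [eapply is_RInt_ext; [|exact H]|].
- intros x _; rewrite <- pow_mult, Rpow_mult_distr; apply Rmult_assoc.
- assert (E : poch 1 j = INR (fact j)).
  { clear; induction j as [|j IH]; [reflexivity|].
    rewrite fact_simpl, mult_INR, S_INR, <- IH; simpl; ring. }
  unfold hyp_coef; rewrite E, <- pow_mult.
  assert (Hf := INR_fact_neq_0 j).
  assert (Hp := poch_pos (1 / 2) j ltac:(lra)).
  field; split; lra.
Qed.

Lemma is_RInt_odd_hyp_cos2 (N : nat) (a b c s : R) :
  is_RInt (fun x => s * cos x * hyp N a b c ((s * cos x) ^ 2)) 0 (2 * PI) 0.
Proof.
evar_last; [eapply is_RInt_ext; [|apply (is_RInt_sum_f_R0
  (fun j x => hyp_coef a b c j * s ^ (2 * j + 1) * cos x ^ (2 * j + 1))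
  (fun j => hyp_coef a b c j * s ^ (2 * j + 1) * 0) _ _ N)]|].
- intros x _; unfold hyp; rewrite scal_sum; apply sum_eq; intros j _.
  rewrite <- pow_mult, !pow_add, Rpow_mult_distr; simpl; ring.
- intros j; apply is_RInt_Rmult_l, is_RInt_cos_pow_odd.
- rewrite <- (scal_sum _ _ 0); ring.
Qed.

Theorem lemma2 (P : nat -> R -> R) (hP : is_Legendre P) (n : nat) (t : R)
    (ht : Rabs t < 1) :
  1 / (2 * PI) * RInt (fun theta : R => P n (sqrt (1 - t ^ 2) * cos theta))
                      0 (2 * PI)
  = delta n * P n t.
Proof.
set (s := sqrt (1 - t ^ 2)).
assert (Hpi := PI_RGT_0).
destruct (Nat.Even_or_Odd n) as [[m ->]|[m ->]].
- rewrite (proj1 (Legendre_expansion_at_1 P m t hP)).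
  assert (Hs : s ^ 2 = 1 - t ^ 2).
  { apply pow2_sqrt; destruct (Rabs_def2 _ _ ht); nra. }
  rewrite <- Hs.
  erewrite RInt_ext; [|intros x _;
    exact (proj1 (Legendre_expansion_at_0 P m (s * cos x) hP))].
  erewrite is_RInt_unique;
    [|apply is_RInt_Rmult_l, is_RInt_hyp_cos2].
  field; lra.
- rewrite delta_odd.
  erewrite RInt_ext; [|intros x _;
    exact (proj2 (Legendre_expansion_at_0 P m (s * cos x) hP))].
  erewrite is_RInt_unique;
    [|apply is_RInt_Rmult_l, is_RInt_odd_hyp_cos2].
  field; lra.
Qed.
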